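(* Let $a,d,p,\mu$ be integers with $a\ge3$, $d>0$, $0\le p\le\lfloor a/2\rfloor$, $\mu\ge1$ and $\gcd(a,d)=1$. For a nonnegative integer $n$ let $d(n)$ be the number of triples $(x_1,x_2,x_3)$ of nonnegative integers with $ax_1+(a+d)x_2+(a+2d)x_3=n$, and let $s^{(\mu)}_p(a,a+d,a+2d)=\sum n^\mu$, summed over all nonnegative integers $n$ with $d(n)\le p$. For integers $\nu\ge0$ define $S_\nu$ as follows (with the convention $0^0=1$). If $a$ is odd, $$S_\nu=\sum_{j=0}^{\nu}\binom{\nu}{j}\Biggl(\sum_{k=0}^{2p-1}k^{\nu-j}\Bigl(\tfrac{a-1}{2}+p-k\Bigr)^j+(2p)^{\nu-j}\sum_{k=0}^{\frac{a-1}{2}-p}k^j+(2p+1)^{\nu-j}\sum_{k=0}^{\frac{a-1}{2}-p-1}k^j\Biggr)(a+d)^{\nu-j}(a+2d)^j;$$ if $a$ is even, $$S_\nu=\sum_{j=0}^{\nu}\binom{\nu}{j}\Biggl(\sum_{k=1}^{p}\bigl((2k-2)^{\nu-j}+(2k-1)^{\nu-j}\bigr)\Bigl(\tfrac a2+p-2k+1\Bigr)^j+\bigl((2p)^{\nu-j}+(2p+1)^{\nu-j}\bigr)\sum_{k=0}^{\frac a2-p-1}k^j\Biggr)(a+d)^{\nu-j}(a+2d)^j.$$ Then $$s^{(\mu)}_p(a,a+d,a+2d)=\frac{1}{\mu+1}\sum_{\kappa=0}^{\mu}\binom{\mu+1}{\kappa}B_\kappa a^{\kappa-1}S_{\mu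+1-\kappa}+\frac{B_{\mu+1}}{\mu+1}\bigl(a^{\mu+1}-1\bigr).$$
   Context: $B_\kappa$ are the Bernoulli numbers defined by $\frac{x}{e^x-1}=\sum_{\kappa\ge0}B_\kappa\frac{x^\kappa}{\kappa!}$. Empty sums are $0$. *)

(* Defs.v *)
(* MathComp, with the classical sets of MathComp-Analysis. *)
From HB Require Import structures.
From mathcomp Require Import all_boot all_order all_algebra.
From mathcomp Require Import finmap all_classical.

Set Implicit Arguments.
Unset Strict Implicit.
Unset Printing Implicit Defensive.

Import Order.TTheory GRing.Theory Num.Theory.
Local Open Scope ring_scope.

(* Formal power series over the rationals, as sequences of coefficients. *)
Definition ps_mul (f g : nat -> rat) (n : nat) : rat :=
  \sum_(i < n.+1) f i * g (n - i)%N.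

Definition ps_X (n : nat) : rat := (n == 1)%:R.

Definition ps_expB1 (n : nat) : rat := if n is 0 then 0 else (n`!%:R)^-1.

(* x / (e^x - 1) = \sum_k B_k x^k / k!, with the denominator cleared; since
   rational power series form an integral domain, this is the same as the
   equality of the quotient with the series. *)
Definition bernoulli_numbers (B : nat -> rat) : Prop :=
  ps_mul (fun k => B k / k`!%:R) ps_expB1 =1 ps_X.

(* The coefficient of x^(n+1) in the defining identity determines B_n from the
   previous values. *)
Lemma bernoulli_numbersP (B : nat -> rat) :
  bernoulli_numbers B <->
  forall n, B n = n`!%:R * ((n == 0)%:R -
    \sum_(i < n) B i / i`!%:R * ps_expB1 (n.+1 - i)%N).
Proof.
have fN0 n : n`!%:R != 0 :> rat by rewrite pnatr_eq0 -lt0n fact_gt0.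
have E n : ps_mul (fun k => B k / k`!%:R) ps_expB1 n.+1 =
    \sum_(i < n) B i / i`!%:R * ps_expB1 (n.+1 - i)%N + B n / n`!%:R.
  by rewrite /ps_mul !big_ord_recr /= subnn mulr0 addr0 subSnn /= invr1 mulr1.
split=> [HB n | HB [|n]].
- have := HB n.+1; rewrite E /ps_X eqSS => <-.
  by rewrite addrAC subrr add0r mulrC divfK.
- by rewrite /ps_mul big_ord1 /= mulr0.
- by rewrite E (HB n) mulrAC divff // mul1r /ps_X eqSS addrC subrK.
Qed.

Lemma bernoulli_numbers_unique (B B' : nat -> rat) :
  bernoulli_numbers B -> bernoulli_numbers B' -> B =1 B'.
Proof.
move=> /bernoulli_numbersP HB /bernoulli_numbersP HB'.
elim/ltn_ind=> n IHn; rewrite HB HB'; congr (_ * (_ - _)).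
by apply: eq_bigr => i _; rewrite IHn.
Qed.

Lemma bernoulli_numbers_exist : exists B, bernoulli_numbers B.
Proof.
pose step (s : seq rat) : rat := let n := size s in
  n`!%:R * ((n == 0)%:R - \sum_(i < n) s`_i / i`!%:R * ps_expB1 (n.+1 - i)%N).
pose s n := iter n (fun s => rcons s (step s)) [::].
have size_s n : size (s n) = n by elim: n => //= n IHn; rewrite size_rcons IHn.
have sE n i : (i < n)%N -> (s n)`_i = step (s i).
  elim: n => //= n IHn; rewrite ltnS nth_rcons size_s leq_eqVlt.
  by case/orP=> [/eqP-> | lt_in]; rewrite ?ltnn ?eqxx // lt_in IHn.
exists (fun n => step (s n)); apply/bernoulli_numbersP => n.
rewrite {1}/step size_s; congr (_ * (_ - _)).
by apply: eq_bigr => i _; rewrite sE.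
Qed.

(* The solution set is finite as soon as a1, a2, a3 > 0 (fset_set sends an
   infinite set to the empty one). *)
Definition denumerant (a1 a2 a3 n : nat) : nat :=
  #|` fset_set [set x : nat * nat * nat |
        (a1 * x.1.1 + a2 * x.1.2 + a3 * x.2)%N = n]%classic |.

Definition p_gaps (p a1 a2 a3 : nat) : set nat :=
  [set n | (denumerant a1 a2 a3 n <= p)%N]%classic.

(* Meaningful when p_gaps p a1 a2 a3 is finite: \sum_(n \in A) is 0 when
   infinitely many terms are nonzero. *)
Definition sylvester_sum (p mu a1 a2 a3 : nat) : rat :=
  \sum_(n \in p_gaps p a1 a2 a3) (n%:R ^+ mu : rat).

(* The half-open ranges k < m encode sums up to m - 1, empty for m = 0; the
   natural-number subtractions h - p are exact when p <= h, and x ^+ 0 = 1 also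
   for x = 0. *)
Definition S_odd (a d p nu : nat) : rat :=
  let h := (a.-1)./2 in
  \sum_(0 <= j < nu.+1) 'C(nu, j)%:R *
    (\sum_(0 <= k < 2 * p) k%:R ^+ (nu - j) * (h%:R + p%:R - k%:R) ^+ j
     + (2 * p%:R) ^+ (nu - j) * \sum_(0 <= k < (h - p).+1) k%:R ^+ j
     + (2 * p%:R + 1) ^+ (nu - j) * \sum_(0 <= k < h - p) k%:R ^+ j)
    * (a%:R + d%:R) ^+ (nu - j) * (a%:R + 2 * d%:R) ^+ j.

Definition S_even (a d p nu : nat) : rat :=
  let h := a./2 in
  \sum_(0 <= j < nu.+1) 'C(nu, j)%:R *
    (\sum_(1 <= k < p.+1)
       ((2 * k%:R - 2) ^+ (nu - j) + (2 * k%:R - 1) ^+ (nu - j))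
       * (h%:R + p%:R - 2 * k%:R + 1) ^+ j
     + ((2 * p%:R) ^+ (nu - j) + (2 * p%:R + 1) ^+ (nu - j))
       * \sum_(0 <= k < h - p) k%:R ^+ j)
    * (a%:R + d%:R) ^+ (nu - j) * (a%:R + 2 * d%:R) ^+ j.

Definition S_nu (a d p nu : nat) : rat :=
  if odd a then S_odd a d p nu else S_even a d p nu.

(* Main.v *)
(* A solution (x1, x2, x3) for n is determined by (x2, x3), and the pairs which
   occur are those with (a + d) x2 + (a + 2 d) x3 congruent to n modulo a and at
   most n.  Hence n has at most p solutions exactly when n is smaller than m_r,
   the (p+1)-st smallest of these values, where d r = n modulo a.  This pair is
   explicit, and the pairs (x2, x3) attached to the m_r for 0 <= r < a are those
   enumerated in S_nu, so that S_nu is the sum of the m_r ^ nu.  Summing n ^ mu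
   over the n < m_r in a residue class telescopes, by
   b(x + 1) - b(x) = (mu + 1) x ^ mu for b the Bernoulli polynomial of degree
   mu + 1, to a ^ mu (b(m_r / a) - b(i / a)) / (mu + 1) with i = m_r mod a; the
   second terms are summed by the multiplication theorem. *)
Require Import Defs.
From HB Require Import structures.
From mathcomp Require Import all_boot all_order all_algebra.
From mathcomp Require Import finmap all_classical.
From mathcomp Require Import zify ring.

Set Implicit Arguments.
Unset Strict Implicit.
Unset Printing Implicit Defensive.

Import Order.TTheory GRing.Theory Num.Theory.
Local Open Scope ring_scope.

(** * Bernoulli polynomials: difference equation and multiplication theorem *)

Lemma deriv_eq0_const (p : {poly rat}) : p^`() = 0 -> p = (p`_0)%:P.
Proof.
move=> dp0; apply/polyP=> -[|i]; rewrite coefC //=.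
have /eqP := coef_deriv p i; rewrite dp0 coef0 eq_sym -mulr_natr mulf_eq0.
by rewrite pnatr_eq0 orbF => /eqP.
Qed.

(** Subtracting the value at 0 leaves a polynomial that vanishes at every natural number, which is
    more roots than its size allows. *)
Lemma periodic_poly_const (p : {poly rat}) :
  (forall x, p.[x + 1] = p.[x]) -> p = (p`_0)%:P.
Proof.
move=> per; apply/eqP; rewrite -subr_eq0; apply/negPn/negP => q0.
pose rs : seq rat := [seq n%:R | n <- iota 0 (size (p - (p`_0)%:P))].
have rs_roots : all (root (p - (p`_0)%:P)) rs.
  apply/allP=> _ /mapP[n _ ->]; rewrite rootE !hornerE subr_eq0 -horner_coef0.
  by elim: n => [|n]; rewrite ?mulr0n // -natr1 per.
have rs_uniq : uniq rs.
  by rewrite map_inj_uniq ?iota_uniq // => i j /eqP; rewrite eqr_nat => /eqP.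
by have := max_poly_roots q0 rs_roots rs_uniq; rewrite size_map size_iota ltnn.
Qed.

Section BernoulliPolynomials.

Variables (B : nat -> rat) (hB : bernoulli_numbers B).

Definition bernoulli_poly (n : nat) : {poly rat} :=
  \sum_(i < n.+1) ('C(n, i)%:R * B i) *: 'X^(n - i).

Lemma horner_bernoulli_poly n x :
  (bernoulli_poly n).[x] = \sum_(i < n.+1) 'C(n, i)%:R * B i * x ^+ (n - i).
Proof.
rewrite horner_sum; apply: eq_bigr => i _.
by rewrite hornerZ hornerXn.
Qed.

Lemma bernoulli_poly0 n : (bernoulli_poly n).[0] = B n.
Proof.
rewrite horner_bernoulli_poly big_ord_recr /= subnn binn expr0 mulr1 mul1r.
rewrite big1 ?add0r // => i _; rewrite expr0n.
by rewrite subn_eq0 leqNgt ltn_ord mulr0.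
Qed.

Lemma deriv_bernoulli_poly n :
  (bernoulli_poly n.+1)^`() = n.+1%:R *: bernoulli_poly n.
Proof.
rewrite /bernoulli_poly big_ord_recr /= subnn expr0 derivD derivZ derivC.
rewrite scaler0 addr0 (big_morph _ (@derivD rat) (derivC 0)) scaler_sumr.
apply: eq_bigr => i _.
have lein : (i <= n)%N by rewrite -ltnS.
rewrite derivZ derivXn subSn //= scalerA -scaler_nat scalerA.
congr (_ *: _); have := mul_bin_down n.+1 i.
rewrite subSn // => /(congr1 (fun k => k%:R : rat)).
by rewrite !natrM => E; rewrite mulrAC [RHS]mulrA E; ring.
Qed.

(** This is [n!] times the coefficient of [x^n] in the defining identity; the term [i = n], absent
    there because [ps_expB1 0 = 0], accounts for [B n]. *)
Lemma sum_bernoulli_numbers n :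
  \sum_(i < n.+1) 'C(n, i)%:R * B i = B n + (n == 1)%:R.
Proof.
have f0 k : k`!%:R != 0 :> rat by rewrite pnatr_eq0 -lt0n fact_gt0.
rewrite big_ord_recr /= binn mul1r addrC; congr (_ + _).
have := hB n; rewrite /ps_mul big_ord_recr /= subnn mulr0 addr0 /ps_X => E.
transitivity (n`!%:R * (n == 1)%:R : rat); last first.
  by case: eqP => [->|_]; rewrite ?mul1r ?mulr0.
rewrite -E mulr_sumr; apply: eq_bigr => i _; have ltin := ltn_ord i.
have -> : ps_expB1 (n - i) = ((n - i)`!%:R)^-1.
  by move: ltin; rewrite -subn_gt0; case: (n - i)%N.
rewrite -(bin_fact (ltnW ltin)) !natrM.
by field; rewrite !f0.
Qed.

Lemma bernoulli_poly_shift n x :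
  (bernoulli_poly n).[x + 1] = (bernoulli_poly n).[x] + n%:R * x ^+ n.-1.
Proof.
(* The defect [D] satisfies [D(n+1)' = (n+1) D(n)] and vanishes at 0 by the recurrence for [B], so
   it is zero by induction. *)
pose D n :=
  bernoulli_poly n \Po ('X + 1) - bernoulli_poly n - n%:R *: 'X^(n.-1).
have DE k y : (D k).[y] =
    (bernoulli_poly k).[y + 1] - (bernoulli_poly k).[y] - k%:R * y ^+ k.-1.
  by rewrite /D !hornerE horner_comp !hornerE.
have D0 k : (D k).[0] = 0.
  rewrite DE add0r bernoulli_poly0 horner_bernoulli_poly.
  under eq_bigr do rewrite expr1n mulr1.
  rewrite sum_bernoulli_numbers expr0n.
  by case: k => [|[|k]] /=; rewrite ?mulr1 ?mulr0; ring.
suff : D n = 0.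
  move/(congr1 (horner^~ x)); rewrite /= horner0 DE -addrA -opprD.
  exact: subr0_eq.
elim: n {x} => [|n IHn].
  rewrite /D /bernoulli_poly big_ord1 subnn expr0 comp_polyZ comp_polyC subrr.
  by rewrite scale0r subr0.
have dD : (D n.+1)^`() = n.+1%:R *: D n.
  rewrite /D !derivB deriv_comp deriv_bernoulli_poly derivZ derivXn.
  rewrite derivD derivX -[1]/(1%:P) derivC addr0 mulr1.
  rewrite comp_polyZ !scalerBr /= -(scaler_nat n 'X^(n.-1)).
  by [].
move: dD; rewrite IHn scaler0 => /deriv_eq0_const ->.
by rewrite -horner_coef0 D0.
Qed.

(* The two sides have the same increment from x to x + 1, so their difference
   is a periodic polynomial, hence constant; differentiating this fact in degree
   n.+1 shows that the difference in degree n vanishes. *)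
Lemma bernoulli_poly_mult a n x : (0 < a)%N ->
  a%:R ^+ n * (\sum_(k < a) (bernoulli_poly n).[(x + k%:R) / a%:R]) =
  a%:R * (bernoulli_poly n).[x].
Proof.
move=> a_gt0; have a0 : a%:R != 0 :> rat by rewrite pnatr_eq0 -lt0n.
pose G n := a%:R ^+ n *: (\sum_(k < a)
    (bernoulli_poly n \Po (a%:R^-1 *: 'X + (k%:R / a%:R)%:P)))
  - a%:R *: bernoulli_poly n.
have GE k y : (G k).[y] =
    a%:R ^+ k * (\sum_(i < a) (bernoulli_poly k).[(y + i%:R) / a%:R])
    - a%:R * (bernoulli_poly k).[y].
  rewrite /G !hornerE horner_sum; congr (_ * _ - _); apply: eq_bigr => i _.
  by rewrite horner_comp !hornerE mulrDl [y / _]mulrC.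
have Gper k y : (G k).[y + 1] = (G k).[y].
  rewrite !GE; case: a a_gt0 a0 {G GE} => // b _ b0.
  (* Passing to [y + 1] shifts the index by one: the term at [y / a] is lost and one at [y / a + 1]
     is gained. *)
  rewrite big_ord_recr big_ord_recl /= addr0.
  have -> : (y + 1 + b%:R) / b.+1%:R = y / b.+1%:R + 1.
    by rewrite -natr1; field; rewrite natr1.
  rewrite !bernoulli_poly_shift.
  under eq_bigr do rewrite -addrA nat1r.
  case: k => [|k]; first by rewrite !mul0r !addr0 [X in _ * X]addrC.
  set z := b.+1%:R in b0 *; rewrite expr_div_n /= exprS.
  by field; rewrite expf_neq0.
have dG : (G n.+1)^`() = (n.+1%:R) *: G n.
  rewrite /G derivB !derivZ (big_morph _ (@derivD rat) (derivC 0)).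
  rewrite deriv_bernoulli_poly !scalerBr !scalerA.
  rewrite [n.+1%:R * a%:R]mulrC; congr (_ - _).
  rewrite !scaler_sumr; apply: eq_bigr => i _.
  rewrite deriv_comp deriv_bernoulli_poly derivD derivC addr0 derivZ derivX.
  rewrite comp_polyZ alg_polyC mulrC mul_polyC !scalerA.
  by congr (_ *: _); rewrite exprS; field.
have : n.+1%:R *: G n = 0.
  by rewrite -dG (periodic_poly_const (Gper n.+1)) derivC.
move/eqP; rewrite scaler_eq0 pnatr_eq0 /= => /eqP /(congr1 (horner^~ x)).
by rewrite horner0 GE => /eqP; rewrite subr_eq0 => /eqP.
Qed.

End BernoulliPolynomials.

(** * Ordering the pairs [(x2, x3)] within a residue class *)

(* For r < a and i <= a./2, the pair (sol2 a r i, sol3 a r i) is the i-th one,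
   counting from 0, among the pairs (x2, x3) with x2 + 2 x3 = r modulo a,
   ordered by (a + d) x2 + (a + 2 d) x3 = a (x2 + x3) + d (x2 + 2 x3).
   Its weight x2 + 2 x3 is r for the first r./2 + 1 pairs, and then r + a. *)
Definition sol_weight (a r i : nat) : nat :=
  if (i <= r./2)%N then r else (r + a)%N.

Definition sol3 (a r i : nat) : nat :=
  if (i <= r./2)%N then (r./2 - i)%N else ((r + a)./2 + (r./2).+1 - i)%N.

Definition sol2 (a r i : nat) : nat := (sol_weight a r i - 2 * sol3 a r i)%N.

Definition sol_val (a d r i : nat) : nat :=
  (a * (sol2 a r i + sol3 a r i) + d * sol_weight a r i)%N.

Lemma sol_weightE a r i : (r < a)%N -> (i <= a./2)%N ->
  (sol2 a r i + 2 * sol3 a r i)%N = sol_weight a r i.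
Proof.
by move=> ra ia; rewrite /sol2 /sol3 /sol_weight; case: ifP; lia.
Qed.

Lemma sol_valE a d r i : (r < a)%N -> (i <= a./2)%N ->
  sol_val a d r i = ((a + d) * sol2 a r i + (a + 2 * d) * sol3 a r i)%N.
Proof. by move=> ra ia; rewrite /sol_val -sol_weightE //; ring. Qed.

Lemma sol_val_mod a d r i : sol_val a d r i = d * r %[mod a].
Proof.
rewrite /sol_val mulnC modnMDl /sol_weight; case: ifP => // _.
by rewrite mulnDr addnC modnMDl.
Qed.

(** From [i] to [j] the sum [x2 + x3] grows strictly and the weight does not decrease. *)
Lemma sol_val_lt a d r i j : (r < a)%N -> (i < j)%N -> (j <= a./2)%N ->
  (sol_val a d r i < sol_val a d r j)%N.
Proof.
move=> ra ij ja.
have K : (sol2 a r i + sol3 a r i < sol2 a r j + sol3 a r j)%N.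
  by rewrite /sol2 /sol3 /sol_weight; do 2 case: ifP; lia.
have W : (sol_weight a r i <= sol_weight a r j)%N.
  by rewrite /sol_weight; do 2 case: ifP; lia.
rewrite /sol_val -addSn leq_add // ?leq_mul2l ?W ?orbT //.
by rewrite ltn_mul2l K andbT; lia.
Qed.

(* Within a residue class, every pair of weight r precedes those of weight
   r + a, and these precede the pairs of larger weight as long as p <= a / 2. *)
Lemma sol_val_gtP a d r p x y q : (r < a)%N -> (p <= a./2)%N ->
  (x + 2 * y = r + q * a)%N ->
  (a * (x + y) + d * (x + 2 * y) < sol_val a d r p)%N ->
  exists2 i, (i < p)%N & x = sol2 a r i /\ y = sol3 a r i.
Proof.
move=> ra pa E; rewrite /sol_val => lt.
have nle : (sol_weight a r p <= x + 2 * y -> x + y < sol2 a r p + sol3 a r p)%N.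
  move=> W; rewrite ltnNge; apply/negP => K; move: lt; rewrite ltnNge.
  by rewrite leq_add // leq_mul2l ?W ?K ?orbT.
(* For [q = 0] and [q = 1] the index comes from solving [sol3 a r i = y] for [i]. *)
case: q E => [|[|q]] E.
- exists (r./2 - y)%N; move: nle;
    by rewrite /sol2 /sol3 /sol_weight; do 2? case: ifP; lia.
- exists ((r + a)./2 + (r./2).+1 - y)%N; move: nle;
    by rewrite /sol2 /sol3 /sol_weight; do 2? case: ifP; lia.
(* Here [x + y] is at least [a], whereas the [p]-th pair has sum at most [a] because [p <= a./2]. *)
exfalso; have {}E : (r + 2 * a <= x + 2 * y)%N by nia.
by move: nle; rewrite /sol2 /sol3 /sol_weight; case: ifP; lia.
Qed.

(** * Counting the solutions for a given [n] *)

Lemma card_fset_set_le (T : choiceType) (A : set T) (s : seq T) :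
  (forall x, A x -> x \in s) -> (#|` fset_set A| <= size s)%N.
Proof.
move=> As; have finA : finite_set A.
  by apply: (@sub_finite_set _ _ [set` s]%classic).
apply: (@leq_trans #|` [fset x in s]%fset|); last first.
  by rewrite card_fseq size_undup.
apply: fsubset_leq_card; apply/fsubsetP => x.
by rewrite in_fset_set // inE => /As; rewrite !inE.
Qed.

Lemma leq_card_fset_set (T : choiceType) (A : set T) (s : seq T) :
  finite_set A -> uniq s -> (forall x, x \in s -> A x) ->
  (size s <= #|` fset_set A|)%N.
Proof.
move=> finA us sA.
have <- : size [fset x in s]%fset = size s by rewrite card_fseq undup_id.
apply: fsubset_leq_card; apply/fsubsetP => x.
by rewrite in_fset_set // !inE => /sA.
Qed.

Lemma finite_solutions a1 a2 a3 n : (0 < a1)%N -> (0 < a2)%N -> (0 < a3)%N ->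
  finite_set [set x : nat * nat * nat |
    (a1 * x.1.1 + a2 * x.1.2 + a3 * x.2)%N = n]%classic.
Proof.
move=> h1 h2 h3; have [N nN] : exists N, (n < N)%N by exists n.+1.
pose I := iota 0 N.
pose box := [seq (xy, z) | xy <- [seq (x, y) | x <- I, y <- I], z <- I].
apply: (@sub_finite_set _ _ [set` box]%classic) => //.
move=> [[x y] z] /= E; apply: (allpairs_f pair).
  by apply: (allpairs_f pair); rewrite mem_iota; nia.
by rewrite mem_iota; nia.
Qed.

Lemma coprime_modMl_inj a d m n :
  coprime a d -> d * m = d * n %[mod a] -> m = n %[mod a].
Proof.
move=> cad; wlog lemn : m n / (m <= n)%N.
  by case/orP: (leq_total m n) => le H; [apply: H | move/esym/H => ->].
move/esym/eqP; rewrite eqn_mod_dvd ?leq_mul2l ?lemn ?orbT // -mulnBr.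
by rewrite Gauss_dvdr // -eqn_mod_dvd // => /eqP.
Qed.

Lemma denumerant_leP a d p r n : (0 < a)%N -> (p <= a./2)%N ->
  coprime a d -> (r < a)%N -> n = d * r %[mod a] ->
  (denumerant a (a + d) (a + 2 * d) n <= p)%N = (n < sol_val a d r p)%N.
Proof.
move=> a0 pa cad ra nr.
(* The solution built on the [i]-th pair. Below the threshold every solution is one of the first [p]
   values of [f]; otherwise the first [p + 1] values are distinct solutions. *)
pose f i := (((n - sol_val a d r i) %/ a)%N, sol2 a r i, sol3 a r i).
apply/idP/idP; last first.
  move=> lt;   rewrite -[p](size_iota 0) -(size_map f); apply: card_fset_set_le.
  move=> [[x y] z] /= E.
  have E' : (a * x + (a * (y + z) + d * (y + 2 * z)))%N = n by rewrite -E; ring.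
  have : (d * (y + 2 * z) = d * r %[mod a])%N.
    by rewrite -nr -E' (mulnC a x) modnMDl (mulnC a (y + z)%N) modnMDl.
  move/(coprime_modMl_inj cad).
  rewrite (modn_small ra) => mr.
  have W : (y + 2 * z = r + (y + 2 * z) %/ a * a)%N.
    by rewrite {1}(divn_eq (y + 2 * z) a) mr addnC.
  have [|i ip [ey ez]] := sol_val_gtP (d := d) ra pa W.
    by apply: leq_ltn_trans lt; rewrite -E' leq_addl.
  apply/mapP; exists i; first by rewrite mem_iota.
  rewrite /f -ey -ez; congr (_, _, _).
  rewrite sol_valE ?(leq_trans (ltnW ip)) // -ey -ez -E.
  by rewrite -addnA addnK mulKn.
move=> le; rewrite ltnNge; apply/negP => ge; move: le; apply/negP.
rewrite -ltnNge.
rewrite -[p.+1](size_iota 0) -(size_map f); apply: leq_card_fset_set.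
- by apply: finite_solutions; lia.
- rewrite map_inj_in_uniq ?iota_uniq // => i j.
  rewrite !mem_iota !ltnS /= => ip jp [_ e2 e3].
  have ia := leq_trans ip pa; have ja := leq_trans jp pa.
  have eqv : sol_val a d r i = sol_val a d r j by rewrite !sol_valE // e2 e3.
  case: (ltngtP i j) => // /(sol_val_lt d ra); [move/(_ ja) | move/(_ ia)];
    by rewrite eqv ltnn.
move=> _ /mapP[i + ->]; rewrite mem_iota ltnS /= => ip.
have ia := leq_trans ip pa.
(* This makes the truncated subtraction in [f] exact. *)
have le : (sol_val a d r i <= n)%N.
  apply: leq_trans ge; case: (ltngtP i p) ip => // [lt _|-> //].
  exact/ltnW/sol_val_lt.
rewrite mulnC -addnA -sol_valE // divnK ?subnK //.
by rewrite -eqn_mod_dvd // nr sol_val_mod.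
Qed.

(** * Power sums over a residue class *)

Lemma big_residue (V : zmodType) (F : nat -> V) a l i : (i < a)%N ->
  \sum_(0 <= n < i + l * a | (n == i %[mod a])%N) F n =
  \sum_(0 <= j < l) F (i + j * a)%N.
Proof.
move=> ia; have a0 : (0 < a)%N by lia.
elim: l => [|l IHl].
  rewrite mul0n addn0 [RHS]big_geq // big_nat_cond big1 // => n.
  case/andP=> /andP[_ ni].
  by rewrite !modn_small ?(ltn_trans ni) // => /eqP ein; rewrite ein ltnn in ni.
rewrite big_nat_recr //= -IHl mulSn [(a + _)%N]addnC addnA.
rewrite (big_cat_nat (n := i + l * a)) ?leq_addr //=; congr (_ + _).
(* Of the [a] consecutive integers in the new block, only the first lies in the class of [i]. *)
rewrite big_ltn_cond; last by lia.
rewrite addnC modnMDl eqxx big_nat_cond big1 ?addr0 // => n /andP[/andP[n1 n2]].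
have [t En] : exists t, n = (l * a + (i + t))%N.
  by exists (n - (l * a + i))%N; lia.
rewrite En modnMDl -[X in _ == modn X _]addn0 eqn_modDl mod0n modn_small; lia.
Qed.

Lemma sum_powers_residue B a mu m : bernoulli_numbers B -> (0 < a)%N ->
  mu.+1%:R * (\sum_(0 <= n < m | (n == m %[mod a])%N) n%:R ^+ mu) =
  a%:R ^+ mu * ((bernoulli_poly B mu.+1).[m%:R / a%:R]
    - (bernoulli_poly B mu.+1).[(m %% a)%N%:R / a%:R]).
Proof.
move=> hB a0; have aN0 : a%:R != 0 :> rat by rewrite pnatr_eq0 -lt0n.
rewrite {1 2 3}(divn_eq m a) addnC.
under eq_bigl do rewrite [(m %% a + _)%N]addnC modnMDl.
rewrite big_residue ?ltn_mod //.
elim: (m %/ a)%N => [|l IHl].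
  by rewrite big_geq // mul0n addn0 subrr !mulr0.
rewrite big_nat_recr //= mulrDr IHl.
have -> : (m %% a + l.+1 * a)%N%:R / a%:R =
    (m %% a + l * a)%N%:R / a%:R + 1 :> rat.
  by rewrite mulSn [(a + _)%N]addnC addnA natrD mulrDl divff.
rewrite bernoulli_poly_shift //= expr_div_n.
by field; rewrite expf_neq0.
Qed.

(** * Splitting the sum over the gaps by residue class *)

Lemma mul_mod_inj a d : coprime a d ->
  forall i j : 'I_a, d * i = d * j %[mod a] -> i = j.
Proof.
move=> cad i j /(coprime_modMl_inj cad); rewrite !modn_small // => ?.
exact: val_inj.
Qed.

Section ResidueBijection.

Variables (a d p : nat) (a0 : (0 < a)%N) (cad : coprime a d).

Definition mul_mod_ord (r : 'I_a) : 'I_a := Ordinal (ltn_pmod (d * r) a0).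

Lemma mul_mod_ord_inj : injective mul_mod_ord.
Proof.
by move=> i j /(congr1 val) /= E; apply: (mul_mod_inj cad).
Qed.

Lemma sum_sol_val_mod (V : nmodType) (F : nat -> V) :
  \sum_(r < a) F (sol_val a d r p %% a)%N = \sum_(i < a) F i.
Proof.
rewrite [RHS](reindex_inj mul_mod_ord_inj).
by apply: eq_bigr => r _; rewrite sol_val_mod.
Qed.

Lemma sum_p_gaps (F : nat -> rat) : (p <= a./2)%N ->
  finite_set (p_gaps p a (a + d) (a + 2 * d)) /\
  \sum_(n \in p_gaps p a (a + d) (a + 2 * d)) F n =
  \sum_(r < a) \sum_(0 <= n < sol_val a d r p
    | (n == sol_val a d r p %[mod a])%N) F n.
Proof.
move=> pa; have [g gK hK] := injF_bij mul_mod_ord_inj.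
(* [idx n] is the [r] with [d * r] congruent to [n]. *)
pose idx n := g (Ordinal (ltn_pmod n a0)).
have idxP n : n = d * idx n %[mod a].
  by have /(congr1 val) /= := hK (Ordinal (ltn_pmod n a0)).
(* A common bound puts all gaps in one list, which is then partitioned by [idx]. *)
pose M := (\max_(r < a) sol_val a d r p)%N.
have leM (r : 'I_a) : (sol_val a d r p <= M)%N.
  exact: (leq_bigmax (F := fun r : 'I_a => sol_val a d r p)).
pose s := [seq n <- index_iota 0 M | (n < sol_val a d (idx n) p)%N].
have gE : p_gaps p a (a + d) (a + 2 * d) = [set` s]%classic.
  apply/seteqP; split=> n; rewrite /p_gaps /= mem_filter mem_index_iota /=
    (@denumerant_leP _ _ _ (idx n)) //.
    by move=> lt; rewrite lt (leq_trans lt).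
  by case/andP.
rewrite gE; split=> //.
rewrite -fsbig_seq ?filter_uniq ?iota_uniq // big_filter.
rewrite (partition_big idx xpredT) //=; apply: eq_bigr => r _.
rewrite [RHS](big_nat_widen _ _ _ _ _ (leM r)); apply: eq_bigl => n.
apply/andP/andP => [[lt /eqP <-]|[/eqP E lt]].
  by rewrite sol_val_mod -idxP eqxx.
have -> : idx n = r by apply: (mul_mod_inj cad); rewrite -idxP E sol_val_mod.
by [].
Qed.

End ResidueBijection.

(** * Identification of [S_nu] with a sum of powers *)

Lemma sum_parity (V : nmodType) (G : nat -> V) m :
  \sum_(0 <= r < 2 * m) G r =
  \sum_(0 <= k < m) (G (2 * k)%N + G (2 * k).+1).
Proof.
elim: m => [|m IHm]; first by rewrite !big_geq.
by rewrite mulnS !add2n !big_nat_recr //= IHm addrA.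
Qed.

(** The weight changes at [r = 2 * p]. Below it, [r = 2 * p - 1 - k] gives [x2 = k]. For
    [r = 2 * p + s], [x3 = s./2] and [x2] is [2 * p] or [2 * p + 1] by the parity of [s]; as [a] is
    odd, there is one more even [s]. *)
Lemma sum_sol_odd (V : nmodType) (F : nat -> nat -> V) a p :
  odd a -> (p <= a./2)%N ->
  let h := (a.-1)./2 in
  \sum_(0 <= r < a) F (sol2 a r p) (sol3 a r p) =
  \sum_(0 <= k < 2 * p) F k (h + p - k)%N
  + \sum_(0 <= k < (h - p).+1) F (2 * p)%N k
  + \sum_(0 <= k < h - p) F (2 * p + 1)%N k.
Proof.
move=> odda pa h; rewrite (big_cat_nat (n := (2 * p)%N)) //=; last by lia.
rewrite -addrA; congr (_ + _).
  rewrite big_nat_rev; apply: eq_big_nat => k /= kp.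
  by congr F; rewrite /sol2 /sol3 /sol_weight; case: ifP; lia.
have -> : a = ((2 * (h - p)).+1 + 2 * p)%N by lia.
rewrite -{1}[(2 * p)%N]add0n big_addn addnK big_nat_recr //= sum_parity.
rewrite big_split /= addrAC big_nat_recr //=; congr (_ + _ + _);
  try apply: eq_big_nat => k /= kp;
  by congr F; rewrite /sol2 /sol3 /sol_weight; case: ifP; lia.
Qed.

(** For even [a] the residues [2 * j] and [2 * j + 1] share the same [x3] on both sides of [2 * p];
    below it, [k = p - j]. *)
Lemma sum_sol_even (V : nmodType) (F : nat -> nat -> V) a p :
  ~~ odd a -> (p <= a./2)%N ->
  let h := a./2 in
  \sum_(0 <= r < a) F (sol2 a r p) (sol3 a r p) =
  \sum_(1 <= k < p.+1) (F (2 * k - 2)%N (h + p + 1 - 2 * k)%N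
                       + F (2 * k - 1)%N (h + p + 1 - 2 * k)%N)
  + \sum_(0 <= k < h - p) (F (2 * p)%N k + F (2 * p + 1)%N k).
Proof.
move=> evena pa h; rewrite (big_cat_nat (n := (2 * p)%N)) //=; last by lia.
congr (_ + _).
  rewrite sum_parity [RHS]big_nat_rev big_add1 /=; apply: eq_big_nat => k /= kp.
  by congr (F _ _ + F _ _); rewrite /sol2 /sol3 /sol_weight; case: ifP; lia.
have -> : a = (2 * (h - p) + 2 * p)%N by lia.
rewrite -{1}[(2 * p)%N]add0n big_addn addnK sum_parity.
apply: eq_big_nat => k /= kp.
by congr (F _ _ + F _ _); rewrite /sol2 /sol3 /sol_weight; case: ifP; lia.
Qed.

Lemma S_nuE a d p nu : (p <= a./2)%N ->
  S_nu a d p nu = \sum_(r < a) (sol_val a d r p)%:R ^+ nu.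
Proof.
move=> pa.
transitivity (\sum_(0 <= j < nu.+1) 'C(nu, j)%:R *
    (\sum_(0 <= r < a) (sol2 a r p)%:R ^+ (nu - j) * (sol3 a r p)%:R ^+ j)
    * (a%:R + d%:R) ^+ (nu - j) * (a%:R + 2 * d%:R) ^+ j : rat); last first.
  (* Each power of [(a + d) * x2 + (a + 2 * d) * x3] is expanded by the binomial theorem and the
     sums are exchanged. *)
  rewrite -(big_mkord xpredT (fun r => (sol_val a d r p)%:R ^+ nu)).
  under [RHS]eq_big_nat => r ra.
    rewrite sol_valE // !(natrD, natrM) exprDn -(big_mkord xpredT (fun j =>
      ((a%:R + d%:R) * (sol2 a r p)%:R) ^+ (nu - j)
      * ((a%:R + 2 * d%:R) * (sol3 a r p)%:R) ^+ j *+ 'C(nu, j))).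
    over.
  rewrite exchange_big; apply: eq_big_nat => j _.
  rewrite mulr_sumr !mulr_suml; apply: eq_big_nat => r _.
  by rewrite !exprMn -mulr_natl; ring.
rewrite /S_nu; case: ifP => [odda | /negbT evena].
  rewrite /S_odd; apply: eq_big_nat => j _.
  rewrite (sum_sol_odd (fun x y => x%:R ^+ (nu - j) * y%:R ^+ j : rat)) //.
  rewrite !mulr_sumr natrD natrM; congr (_ * (_ + _ + _) * _ * _).
  by apply: eq_big_nat => k kp; rewrite natrB ?natrD //; lia.
rewrite /S_even; apply: eq_big_nat => j _.
rewrite (sum_sol_even (fun x y => x%:R ^+ (nu - j) * y%:R ^+ j : rat)) //.
congr (_ * (_ + _) * _ * _); last first.
  by rewrite big_split mulrDl !mulr_sumr natrD natrM.
apply: eq_big_nat => k kp; rewrite -mulrDl; congr (_ * _ ^+ _).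
  by congr (_ ^+ _ + _ ^+ _); rewrite natrB ?natrM //; lia.
by rewrite natrB ?natrD ?natrM; [ring | lia].
Qed.

Theorem theorem3 (a d p mu : nat) (B : nat -> rat)
    (ha : (3 <= a)%N) (hd : (0 < d)%N) (hp : (p <= a./2)%N) (hmu : (1 <= mu)%N)
    (had : coprime a d) (hB : bernoulli_numbers B) :
  finite_set (p_gaps p a (a + d) (a + 2 * d)) /\
  sylvester_sum p mu a (a + d) (a + 2 * d) =
    (mu.+1%:R)^-1 *
      (\sum_(0 <= kappa < mu.+1)
         'C(mu.+1, kappa)%:R * B kappa * a%:R ^ (kappa%:Z - 1)
         * S_nu a d p (mu.+1 - kappa))
    + B mu.+1 / mu.+1%:R * (a%:R ^+ mu.+1 - 1).
Proof.
have a0 : (0 < a)%N by apply: leq_trans ha.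
have aN0 : a%:R != 0 :> rat by rewrite pnatr_eq0 -lt0n.
have muN0 : mu.+1%:R != 0 :> rat by rewrite pnatr_eq0.
have [fin sumE] := sum_p_gaps a0 had (fun n => n%:R ^+ mu) hp.
split=> //; rewrite /sylvester_sum {}sumE.
apply: (mulfI muN0); rewrite mulr_sumr.
under eq_bigr do rewrite (sum_powers_residue _ _ hB a0).
rewrite -mulr_sumr sumrB mulrBr.
pose beta (i : nat) := (bernoulli_poly B mu.+1).[i%:R / a%:R].
rewrite (sum_sol_val_mod p a0 had beta).
(* The multiplication theorem at [x = 0]. *)
have -> : a%:R ^+ mu * (\sum_(i < a) beta i) = B mu.+1.
  apply: (mulfI aN0); rewrite mulrA -exprS -(bernoulli_poly0 B mu.+1).
  rewrite -(bernoulli_poly_mult hB mu.+1 0 a0).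
  by under [in RHS]eq_bigr do rewrite add0r.
rewrite mulrDr mulVKf // mulrA [_ * (B _ / _)]mulrC divfK // mulrBr mulr1 addrA.
congr (_ - _).
(* The constant term [B mu.+1], split off here and summed over the [a] residues, yields the term in
   [a ^ mu.+1]. *)
under eq_bigr do rewrite horner_bernoulli_poly big_ord_recr /= subnn binn
  mul1r mulr1.
rewrite big_split /= sumr_const card_ord mulrDr; congr (_ + _); last first.
  by rewrite -mulr_natr exprSr; ring.
rewrite exchange_big mulr_sumr big_mkord; apply: eq_bigr => k _.
rewrite S_nuE // !mulr_sumr; apply: eq_bigr => r _.
have km : (k <= mu)%N by rewrite -ltnS.
rewrite expfzDr // -exprnP exprN1 expr_div_n.
have -> : a%:R ^+ mu = a%:R ^+ k * a%:R ^+ (mu.+1 - k) / a%:R :> rat.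
  by rewrite -exprD subnKC ?leqW // exprSr mulfK.
by field; rewrite aN0 expf_neq0.
Qed.
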